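(* Let $a\ge 2$ be an integer not divisible by $5$ and let $S=\langle a,a+5\rangle$. Then, with $b$ denoting a non-negative integer satisfying the relevant condition, the largest perfect square ${}^{2}r(S)$ not belonging to $S$ is given by $$ {}^{2}r(S)=\begin{cases} 1 & \text{if } a=2 \text{ or } a=4;\\ 10^2 & \text{if } a=13;\\ (a-6)^2 & \text{if } a=27 \text{ or } a=32;\\[1ex] (a-(5b-2))^2 & \text{if either } (5b+2)^2\le a+5<(5b+3)^2 \text{ and } a\equiv 4 \pmod 5,\\ & \text{or } (5b+2)^2\le 2(a+5)<(5b+3)^2 \text{ and } a\equiv 2 \pmod 5;\\[1ex] (a-(5b-1))^2 & \text{if either } (5b+1)^2\le a+5<(5b+4)^2 \text{ and } a\equiv 1 \pmod 5,\\ & \text{or } (5b+1)^2\le 2(a+5)<(5b+4)^2 \text{ and } a\equiv 3 \pmod 5,\ a\ne 13;\\[1ex] (a-(5b+1))^2 & \text{if either } (5b+4)^2\le a+5<(5b+6)^2 \text{ and } a\equiv 1 \pmod 5,\\ & \text{or } (5b+4)^2\le 2(a+5)<(5b+6)^2 \text{ and } a\equiv 3 \pmod 5;\\[1ex] (a-(5b+2))^2 & \text{if either } (5b+3)^2\le a+5<(5b+7)^2 \text{ and } a\equiv 4 \pmod 5,\ a\ne 4,\\ & \text{or } (5b+3)^2\le 2(a+5)<(5b+7)^2 \text{ and } a\equiv 2 \pmod 5,\ a\notin\{2,27,32\}. \end{cases} $$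
   Context: $\langle s_1,s_2\rangle=\{x_1s_1+x_2s_2 : x_1,x_2 \text{ integers},\ x_1,x_2\ge 0\}$. For a numerical semigroup $S$ with $1\notin S$ (generated by relatively prime positive integers), ${}^{2}r(S)$ denotes the largest perfect square $m^2$ ($m\ge 1$ an integer) not belonging to $S$. *)

(* Defs.v *)
(* Standard library integers Z, so that a - (5b - 2) is genuine subtraction. *)
From Stdlib Require Import ZArith.
Open Scope Z_scope.

Definition gen2 (s1 s2 : Z) : Z -> Prop :=
  fun n => exists x1 x2 : Z, 0 <= x1 /\ 0 <= x2 /\ n = x1 * s1 + x2 * s2.

(* "N = 2r(S)".  A relation rather than a function: it asserts that the largest
   missing square exists and equals N. *)
Definition is_largest_missing_square (S : Z -> Prop) (N : Z) : Prop :=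
  (exists m : Z, 1 <= m /\ N = m ^ 2 /\ ~ S N) /\
  (forall m : Z, 1 <= m -> ~ S (m ^ 2) -> m ^ 2 <= N).

(* Main.v *)
Require Import Defs.
From Stdlib Require Import ZArith Znumtheory Lia.
Open Scope Z_scope.

(** Write a candidate square as [(a - i)^2].  Since [(a - i)^2 = a (a - 2 i) + i^2],
    a representation [x a + y (a + 5)] of it amounts to an integer
    [r = x + y - a + 2 i] with [5 y = i^2 - r a], and the conditions [0 <= y],
    [0 <= x] read [r a <= i^2] and [(i + 5)^2 <= (r + 5) (a + 5)].  The class of
    [r] modulo 5 is forced, so the square is missing exactly when two
    neighbouring values [r = R - 5] and [r = R] of that class both fail:
    [i^2 < R a] and [R (a + 5) < (i + 5)^2], where [R a] is congruent to [i^2].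
    This is [missing_square_iff_gap].  It remains to find the least [i] for which
    such an [R] exists.

    Roughly, [i] must exceed [sqrt (R a) - 5], so small [R] is best.  As [R a] is
    a square modulo 5, the smallest admissible [R] is [k = 1] when [a] is a
    residue (1 or 4) and [k = 2] when it is a nonresidue (2 or 3).  For [R = k]
    the index [i] runs through two opposite classes modulo 5; if [p < i] are
    consecutive elements of their union and
    [(p + 5)^2 <= k (a + 5) < (i + 5)^2], then [i] is the least index with [R = k]
    ([largest_missing_square_of_consecutive]).  The intervals of the case table
    are precisely these.  A larger [R], hence at least 4 if [k = 1] and at least 3
    if [k = 2], gives nothing smaller by comparing sizes
    ([gap_only_1], [gap_only_2]).  The comparison, or the inequality
    [i^2 < k a], breaks down only for [a] in 2, 4, 13, 27, 32, which are the
    sporadic rows, and the comparison is too weak for [a = 3], where the general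
    row nevertheless holds. *)

(** * Missing squares as gaps *)

(** [R] plays the part of the parameter [r] of a representation: the first
    inequality says that [r = R] makes the coefficient of [a + d] negative, the
    second that [r = R - d] makes the coefficient of [a] negative. *)
Definition gap (d a i R : Z) : Prop :=
  (d | i ^ 2 - R * a) /\ i ^ 2 < R * a /\ R * (a + d) < (i + d) ^ 2.

(** A representation needs an [r] in the class of [R] modulo [d].  If [r >= R], its
    coefficient of [a + d] is negative, and otherwise [r <= R - d], which makes
    its coefficient of [a] negative. *)
Lemma missing_square_iff_gap (d a i : Z) :
  0 < d -> 0 < a -> rel_prime a d ->
  (~ gen2 a (a + d) ((a - i) ^ 2) <-> exists R, gap d a i R).
Proof.
  intros Hd Ha Hprime; split.
  - intros Hmiss.
    destruct (rel_prime_bezout _ _ Hprime) as [v u Huv].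
    (* The least [y >= 0] with [d y = i^2] modulo [a] is the best coefficient of
       [a + d]; the corresponding [r] is the largest one with [r a <= i^2]. *)
    pose (y := (u * i ^ 2) mod a).
    pose (q := (u * i ^ 2) / a).
    assert (Hq : u * i ^ 2 = a * q + y) by (apply Z.div_mod; lia).
    assert (Hy : 0 <= y < a) by (apply Z.mod_pos_bound; lia).
    pose (r := v * i ^ 2 + d * q).
    assert (Hr : d * y = i ^ 2 - r * a).
    { replace y with (u * i ^ 2 - a * q) by lia.
      transitivity ((v * a + u * d) * i ^ 2 - r * a);
        [unfold r; ring | rewrite Huv; ring]. }
    assert (Hda : d * y < d * a) by (apply Z.mul_lt_mono_pos_l; lia).
    exists (r + d); repeat split.
    + exists (y - a). lia.
    + lia.
    + destruct (Z.lt_ge_cases ((r + d) * (a + d)) ((i + d) ^ 2)) as [H | H];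
        [exact H | exfalso; apply Hmiss].
      exists (a - 2 * i + r - y), y; repeat split; [|lia|lia].
      apply (Z.mul_nonneg_cancel_l d); lia.
  - intros [R (Hdvd & Hlow & Hhigh)] (x & y & Hx & Hy & Hxy).
    pose (r := x + y - a + 2 * i).
    assert (Hr : d * y = i ^ 2 - r * a) by (unfold r; lia).
    assert (Hdx : 0 <= d * x) by (apply Z.mul_nonneg_nonneg; lia).
    assert (Hdy : 0 <= d * y) by (apply Z.mul_nonneg_nonneg; lia).
    assert (HrR : r < R) by (apply (Z.mul_lt_mono_pos_r a); lia).
    assert (Hmod : (d | R - r)).
    { apply Gauss with (b := a); [|apply rel_prime_sym, Hprime].
      destruct Hdvd as [k Hk]; exists (y - k). lia. }
    assert (HrdR : r + d <= R).
    { apply Z.divide_pos_le in Hmod; lia. }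
    assert ((i + d) ^ 2 <= (r + d) * (a + d)) by (unfold r in *; lia).
    assert ((r + d) * (a + d) <= R * (a + d))
      by (apply Z.mul_le_mono_nonneg_r; lia).
    lia.
Qed.

(** The two inequalities of a gap squeeze [R]: their difference is linear in [i].
    In particular [i] cannot be far below zero, and finitely many pairs
    [(i, R)] lie below any given [i]. *)
Lemma gap_bounds (d a i R : Z) :
  0 < d -> 0 < a -> gap d a i R -> 0 < R /\ R < 2 * i + d.
Proof. intros Hd Ha (_ & Hlow & Hhigh). split; nia. Qed.

(** Squaring is monotone here because [gap_bounds] keeps [j + d] nonnegative. *)
Lemma gap_upper_bound_le (d a i j R : Z) :
  0 < d -> 0 < a -> gap d a j R -> j <= i -> R * (a + d) < (i + d) ^ 2.
Proof.
  intros Hd Ha Hgap Hji.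
  pose proof (gap_bounds _ _ _ _ Hd Ha Hgap).
  destruct Hgap as (_ & _ & Hgap).
  assert ((j + d) ^ 2 <= (i + d) ^ 2) by (apply Z.pow_le_mono_l; lia).
  lia.
Qed.

Lemma largest_missing_square_of_least_gap (d a i R : Z) :
  0 < d -> 0 < a -> rel_prime a d -> i < a -> gap d a i R ->
  (forall j R', gap d a j R' -> i <= j) ->
  is_largest_missing_square (gen2 a (a + d)) ((a - i) ^ 2).
Proof.
  intros Hd Ha Hprime Hi Hgap Hleast; split.
  - exists (a - i); repeat split; [lia|].
    apply missing_square_iff_gap; eauto.
  - intros m Hm Hmiss.
    replace (m ^ 2) with ((a - (a - m)) ^ 2) in Hmiss by ring.
    apply missing_square_iff_gap in Hmiss; [|assumption..].
    destruct Hmiss as [R' HR'].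
    specialize (Hleast _ _ HR'). nia.
Qed.

Lemma largest_missing_square_unique (S : Z -> Prop) (N N' : Z) :
  is_largest_missing_square S N -> is_largest_missing_square S N' -> N = N'.
Proof.
  intros [(m & Hm & -> & Hmiss) Hmax] [(m' & Hm' & -> & Hmiss') Hmax'].
  specialize (Hmax m' Hm' Hmiss'). specialize (Hmax' m Hm Hmiss). lia.
Qed.

(** * Squares modulo 5 *)

Lemma rel_prime_5 (a : Z) : ~ (5 | a) -> rel_prime a 5.
Proof.
  intros H.
  pose proof (Z.div_mod a 5 ltac:(lia)) as Ha.
  pose proof (Z.mod_pos_bound a 5 ltac:(lia)) as Hr.
  assert (a mod 5 <> 0) by (intros H0; apply H, Z.mod_divide; lia).
  set (q := a / 5) in *.
  assert (C : a mod 5 = 1 \/ a mod 5 = 2 \/ a mod 5 = 3 \/ a mod 5 = 4) by lia.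
  apply bezout_rel_prime.
  destruct C as [C | [C | [C | C]]]; rewrite C in Ha.
  - apply (Bezout_intro _ _ _ 1 (- q)). lia.
  - apply (Bezout_intro _ _ _ (-2) (2 * q + 1)). lia.
  - apply (Bezout_intro _ _ _ 2 (- 2 * q - 1)). lia.
  - apply (Bezout_intro _ _ _ (-1) (q + 1)). lia.
Qed.

Lemma sqr_mod_5 (j : Z) : j ^ 2 mod 5 = 0 \/ j ^ 2 mod 5 = 1 \/ j ^ 2 mod 5 = 4.
Proof.
  rewrite Z.pow_2_r, Z.mul_mod by lia.
  pose proof (Z.mod_pos_bound j 5 ltac:(lia)) as Hr.
  assert (C : j mod 5 = 0 \/ j mod 5 = 1 \/ j mod 5 = 2 \/ j mod 5 = 3 \/ j mod 5 = 4)
    by lia.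
  destruct C as [C | [C | [C | [C | C]]]]; rewrite C; cbn; auto.
Qed.

Lemma nonresidue_5 (a j : Z) : a mod 5 = 2 \/ a mod 5 = 3 -> ~ (5 | j ^ 2 - a).
Proof.
  intros Ha [z Hz].
  assert (E : j ^ 2 mod 5 = a mod 5).
  { replace (j ^ 2) with (a + z * 5) by lia. apply Z.mod_add. lia. }
  pose proof (sqr_mod_5 j). lia.
Qed.

Lemma sqr_eq_mod_5 (i j : Z) : (5 | j ^ 2 - i ^ 2) -> (5 | j - i) \/ (5 | j + i).
Proof.
  intros H.
  destruct (Zdivide_dec 5 (j - i)) as [Hji | Hji]; [left; exact Hji | right].
  apply Gauss with (b := j - i); [|apply rel_prime_sym, rel_prime_5, Hji].
  replace ((j - i) * (j + i)) with (j ^ 2 - i ^ 2) by ring. exact H.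
Qed.

(** * The least gap for the difference 5 *)

(** The values [R = 2] and [R = 3] would make a nonresidue a square, and
    [R >= 4] is too large: [R (a + 5) < (j + 5)^2 <= (i + 4)^2]. *)
Lemma gap_only_1 (a i j R : Z) :
  0 < a -> a mod 5 = 1 \/ a mod 5 = 4 -> (i + 4) ^ 2 <= 4 * (a + 5) ->
  gap 5 a j R -> j < i -> R = 1.
Proof.
  intros Ha Hmod Hi Hgap Hji.
  pose proof (gap_bounds 5 a j R ltac:(lia) Ha Hgap) as HR.
  pose proof (gap_upper_bound_le 5 a (i - 1) j R ltac:(lia) Ha Hgap ltac:(lia)) as Hup.
  assert (R < 4) by nia.
  destruct Hgap as (Hdvd & _).
  assert (C : R = 1 \/ R = 2 \/ R = 3) by lia.
  destruct C as [C | [-> | ->]]; [exact C | exfalso ..];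
    revert Hdvd; apply nonresidue_5;
    Z.to_euclidean_division_equations; lia.
Qed.

(** Here [R = 1] would make a nonresidue a square, so the competitors start at
    [R = 3], which is a much narrower margin over [R = 2] than in the residue
    case. *)
Lemma gap_only_2 (a i j R : Z) :
  0 < a -> a mod 5 = 2 \/ a mod 5 = 3 -> (i + 4) ^ 2 <= 3 * (a + 5) ->
  gap 5 a j R -> j < i -> R = 2.
Proof.
  intros Ha Hmod Hi Hgap Hji.
  pose proof (gap_bounds 5 a j R ltac:(lia) Ha Hgap) as HR.
  pose proof (gap_upper_bound_le 5 a (i - 1) j R ltac:(lia) Ha Hgap ltac:(lia)) as Hup.
  assert (R < 3) by nia.
  destruct Hgap as (Hdvd & _).
  assert (C : R = 1 \/ R = 2) by lia.
  destruct C as [-> | C]; [exfalso | exact C].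
  rewrite Z.mul_1_l in Hdvd. exact (nonresidue_5 _ _ Hmod Hdvd).
Qed.

(** The indices [j] with [j^2 = k a] modulo 5 form the classes of [i] and [- i].
    As [p = - i] modulo 5 lies less than 5 below [i], it is the predecessor of [i]
    among them, and the lower bound on [k (a + 5)] shows that [p] and everything
    below it is too small. *)
Lemma largest_missing_square_of_consecutive (a k p i : Z) :
  2 <= a -> ~ (5 | a) -> 1 <= k <= 2 ->
  (5 | i ^ 2 - k * a) -> (5 | p + i) -> p < i < p + 5 -> -5 <= p ->
  (p + 5) ^ 2 <= k * (a + 5) < (i + 5) ^ 2 -> i ^ 2 < k * a ->
  (forall j R, gap 5 a j R -> j < i -> R = k) ->
  is_largest_missing_square (gen2 a (a + 5)) ((a - i) ^ 2).
Proof.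
  intros Ha Ha5 Hk Hdvd [z Hz] Hpi Hp [Hlow Hhigh] Hi Honly.
  assert (Hia : i < a).
  { destruct (Z.lt_ge_cases i a) as [H | H]; [exact H | exfalso].
    assert (a * a <= i * i) by (apply Z.square_le_mono_nonneg; lia).
    assert (k * a <= 2 * a) by (apply Z.mul_le_mono_nonneg_r; lia).
    assert (2 * a <= a * a) by (apply Z.mul_le_mono_nonneg_r; lia).
    lia. }
  apply (largest_missing_square_of_least_gap 5 a i k);
    [lia | lia | apply rel_prime_5, Ha5 | exact Hia | repeat split; assumption |].
  intros j R Hgap.
  destruct (Z.lt_ge_cases j i) as [Hji | Hji]; [exfalso | exact Hji].
  assert (R = k) by eauto. subst R.
  assert (Hjp : j <= p).
  { destruct (sqr_eq_mod_5 i j) as [[w Hw] | [w Hw]]; [|lia|lia].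
    destruct Hgap as ([w Hw] & _). destruct Hdvd as [v Hv].
    exists (w - v). lia. }
  pose proof (gap_upper_bound_le 5 a p j k ltac:(lia) ltac:(lia) Hgap Hjp). lia.
Qed.

(** * Sporadic values *)

(** Only finitely many pairs [(j, R)] compete with [i0], by [gap_bounds].  The
    arguments are the value of [a], the least index [i0] with its [R0], and the
    quotient [z0] of [i0^2 - R0 a0] by 5. *)
Ltac sporadic a0 i0 R0 z0 :=
  apply (largest_missing_square_of_least_gap 5 a0 i0 R0);
    [lia | lia | apply rel_prime_5; intros [z Hz]; lia | lia
    | split; [exists z0; reflexivity | split; lia] |];
  intros j R Hgap; pose proof (gap_bounds 5 a0 j R ltac:(lia) ltac:(lia) Hgap);
  destruct (Z.lt_ge_cases j i0) as [Hji | Hji]; [exfalso | exact Hji];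
  destruct Hgap as ([z Hz] & Hlow & Hhigh);
  assert (C : j = -1 \/ j = 0 \/ j = 1 \/ j = 2 \/ j = 3 \/ j = 4 \/ j = 5) by lia;
  repeat (destruct C as [C | C]); subst j; lia.

Lemma largest_missing_square_2 : is_largest_missing_square (gen2 2 (2 + 5)) 1.
Proof. change 1 with ((2 - 1) ^ 2). sporadic 2 1 3 (-1). Qed.

(** For [a = 3] the bound [(i + 4)^2 <= 3 (a + 5)] of [gap_only_2] just fails,
    as [25 > 24]; the competitor [j = 0], [R = 3] is excluded by its residue. *)
Lemma largest_missing_square_3 :
  is_largest_missing_square (gen2 3 (3 + 5)) ((3 - 1) ^ 2).
Proof. sporadic 3 1 2 (-1). Qed.

Lemma largest_missing_square_4 : is_largest_missing_square (gen2 4 (4 + 5)) 1.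
Proof. change 1 with ((4 - 3) ^ 2). sporadic 4 3 6 (-3). Qed.

Lemma largest_missing_square_13 :
  is_largest_missing_square (gen2 13 (13 + 5)) (10 ^ 2).
Proof. change 10 with (13 - 3). sporadic 13 3 3 (-6). Qed.

Lemma largest_missing_square_27 :
  is_largest_missing_square (gen2 27 (27 + 5)) ((27 - 6) ^ 2).
Proof. sporadic 27 6 3 (-9). Qed.

Lemma largest_missing_square_32 :
  is_largest_missing_square (gen2 32 (32 + 5)) ((32 - 6) ^ 2).
Proof. sporadic 32 6 3 (-12). Qed.

(** * The case table *)

(** The squares of the integers congruent to [l] or [k] modulo 5 cut the half
    line into the intervals of the table; [b] is read off from the integer square
    root of [x]. *)
Lemma square_blocks_cover (l k x : Z) :
  0 <= l -> l <= k <= l + 5 -> l ^ 2 <= x ->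
  exists b, 0 <= b /\
    ((5 * b + l) ^ 2 <= x < (5 * b + k) ^ 2 \/
     (5 * b + k) ^ 2 <= x < (5 * b + (l + 5)) ^ 2).
Proof.
  intros Hl Hk Hx.
  pose proof (Z.sqrt_nonneg x) as Hs0.
  assert (Hls : l <= Z.sqrt x) by (apply Z.sqrt_le_square; lia).
  assert (Hle : forall m, 0 <= m -> m <= Z.sqrt x -> m ^ 2 <= x).
  { intros m Hm Hmx. apply Z.sqrt_le_square in Hmx; lia. }
  assert (Hlt : forall m, 0 <= m -> Z.sqrt x < m -> x < m ^ 2).
  { intros m Hm Hmx. apply Z.sqrt_lt_square in Hmx; lia. }
  pose proof (Z.div_mod (Z.sqrt x - l) 5 ltac:(lia)) as Hb.
  pose proof (Z.mod_pos_bound (Z.sqrt x - l) 5 ltac:(lia)) as Hr.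
  exists ((Z.sqrt x - l) / 5).
  assert (Hb0 : 0 <= (Z.sqrt x - l) / 5) by (apply Z.div_pos; lia).
  split; [exact Hb0|].
  destruct (Z.lt_ge_cases (Z.sqrt x) (5 * ((Z.sqrt x - l) / 5) + k)) as [H | H];
    [left | right]; split; first [apply Hle; lia | apply Hlt; lia].
Qed.

Definition case_table (a N : Z) : Prop :=
    ((a = 2 \/ a = 4) /\ N = 1) \/
    (a = 13 /\ N = 10 ^ 2) \/
    ((a = 27 \/ a = 32) /\ N = (a - 6) ^ 2) \/
    (exists b : Z, 0 <= b /\
      (((5 * b + 2) ^ 2 <= a + 5 < (5 * b + 3) ^ 2 /\ a mod 5 = 4) \/
       ((5 * b + 2) ^ 2 <= 2 * (a + 5) < (5 * b + 3) ^ 2 /\ a mod 5 = 2)) /\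
      N = (a - (5 * b - 2)) ^ 2) \/
    (exists b : Z, 0 <= b /\
      (((5 * b + 1) ^ 2 <= a + 5 < (5 * b + 4) ^ 2 /\ a mod 5 = 1) \/
       ((5 * b + 1) ^ 2 <= 2 * (a + 5) < (5 * b + 4) ^ 2 /\ a mod 5 = 3 /\
        a <> 13)) /\
      N = (a - (5 * b - 1)) ^ 2) \/
    (exists b : Z, 0 <= b /\
      (((5 * b + 4) ^ 2 <= a + 5 < (5 * b + 6) ^ 2 /\ a mod 5 = 1) \/
       ((5 * b + 4) ^ 2 <= 2 * (a + 5) < (5 * b + 6) ^ 2 /\ a mod 5 = 3)) /\
      N = (a - (5 * b + 1)) ^ 2) \/
    (exists b : Z, 0 <= b /\
      (((5 * b + 3) ^ 2 <= a + 5 < (5 * b + 7) ^ 2 /\ a mod 5 = 4 /\ a <> 4) \/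
       ((5 * b + 3) ^ 2 <= 2 * (a + 5) < (5 * b + 7) ^ 2 /\ a mod 5 = 2 /\
        a <> 2 /\ a <> 27 /\ a <> 32)) /\
      N = (a - (5 * b + 2)) ^ 2).

Lemma case_table_has_value (a : Z) : 2 <= a -> ~ (5 | a) -> exists N, case_table a N.
Proof.
  intros Ha Ha5.
  pose proof (Z.mod_pos_bound a 5 ltac:(lia)) as Hr.
  pose proof (Z.div_mod a 5 ltac:(lia)) as Hq.
  assert (Hr0 : a mod 5 <> 0) by (intros H; apply Ha5, Z.mod_divide; lia).
  assert (Hs : (a = 2 \/ a = 4 \/ a = 13 \/ a = 27 \/ a = 32) \/
    (a <> 2 /\ a <> 4 /\ a <> 13 /\ a <> 27 /\ a <> 32)) by lia.
  destruct Hs as [[H | [H | [H | H]]] | Hs];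
    [exists 1; left; auto | exists 1; left; auto | exists (10 ^ 2); right; left; auto
    | exists ((a - 6) ^ 2); right; right; left; auto |].
  assert (C : a mod 5 = 1 \/ a mod 5 = 2 \/ a mod 5 = 3 \/ a mod 5 = 4) by lia.
  destruct C as [C | [C | [C | C]]].
  - destruct (square_blocks_cover 1 4 (a + 5)) as (b & Hb & [Hx | Hx]); [lia..| |].
    + eexists. do 4 right; left. exists b; split; [exact Hb|].
      split; [left; split; assumption | reflexivity].
    + eexists. do 5 right; left. exists b; split; [exact Hb|].
      split; [left; split; assumption | reflexivity].
  - (* The interval from [5 b + 7] to [5 b + 8] is the one from [5 b' + 2] to
       [5 b' + 3] with [b' = b + 1]; for [b' = 0] it lies below [2 (a + 5)]. *)
    destruct (square_blocks_cover 3 7 (2 * (a + 5))) as (b & Hb & [Hx | Hx]); [lia..| |].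
    + eexists. do 6 right. exists b; split; [exact Hb|].
      split; [right; repeat split; first [assumption | apply Hx | apply Hs] | reflexivity].
    + eexists. do 3 right; left. exists (b + 1); split; [lia|].
      split; [right; split; [|exact C] | reflexivity].
      replace (5 * (b + 1) + 2) with (5 * b + 7) by ring.
      replace (5 * (b + 1) + 3) with (5 * b + (3 + 5)) by ring. exact Hx.
  - destruct (square_blocks_cover 1 4 (2 * (a + 5))) as (b & Hb & [Hx | Hx]); [lia..| |].
    + eexists. do 4 right; left. exists b; split; [exact Hb|].
      split; [right; repeat split; first [assumption | apply Hx | apply Hs] | reflexivity].
    + eexists. do 5 right; left. exists b; split; [exact Hb|].
      split; [right; split; assumption | reflexivity].
  - destruct (square_blocks_cover 3 7 (a + 5)) as (b & Hb & [Hx | Hx]); [lia..| |].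
    + eexists. do 6 right. exists b; split; [exact Hb|].
      split; [left; repeat split; first [assumption | apply Hx | apply Hs] | reflexivity].
    + eexists. do 3 right; left. exists (b + 1); split; [lia|].
      split; [left; split; [|exact C] | reflexivity].
      replace (5 * (b + 1) + 2) with (5 * b + 7) by ring.
      replace (5 * (b + 1) + 3) with (5 * b + (3 + 5)) by ring. exact Hx.
Qed.

(** In each general row [p] is the element before [i] of the two classes, and the
    shape of the interval is [(p + 5)^2 <= k (a + 5) < (i + 5)^2].  The remaining
    inequalities are polynomial in [b], true from small [b] on; the first few
    values of [b] bound [a] and, with its class modulo 5, leave only excluded
    values and [a = 3]. *)
Lemma case_table_sound (a N : Z) :
  2 <= a -> ~ (5 | a) -> case_table a N ->
  is_largest_missing_square (gen2 a (a + 5)) N.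
Proof.
  intros Ha Ha5.
  pose proof (Z.div_mod a 5 ltac:(lia)) as Hq.
  set (t := a / 5) in *.
  intros [[[-> | ->] ->] | [[-> ->] | [[[-> | ->] ->] | [H | [H | [H | H]]]]]].
  - exact largest_missing_square_2.
  - exact largest_missing_square_4.
  - exact largest_missing_square_13.
  - exact largest_missing_square_27.
  - exact largest_missing_square_32.
  - destruct H as (b & Hb & [[Hx Hr] | [Hx Hr]] & ->); rewrite Hr in Hq.
    + apply (largest_missing_square_of_consecutive a 1 (5 * b - 3)); [lia | assumption | lia | | | lia | lia | | |].
      * exists (5 * b ^ 2 - 4 * b - t). lia.
      * exists (2 * b - 1). lia.
      * replace (5 * b - 3 + 5) with (5 * b + 2) by ring.
        replace (5 * b - 2 + 5) with (5 * b + 3) by ring. lia.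
      * nia.
      * intros j R. apply gap_only_1; [lia | lia | nia].
    + apply (largest_missing_square_of_consecutive a 2 (5 * b - 3)); [lia | assumption | lia | | | lia | lia | | |].
      * exists (5 * b ^ 2 - 4 * b - 2 * t). lia.
      * exists (2 * b - 1). lia.
      * replace (5 * b - 3 + 5) with (5 * b + 2) by ring.
        replace (5 * b - 2 + 5) with (5 * b + 3) by ring. lia.
      * nia.
      * intros j R. apply gap_only_2; [lia | lia | nia].
  - destruct H as (b & Hb & [[Hx Hr] | (Hx & Hr & H13)] & ->); rewrite Hr in Hq.
    + apply (largest_missing_square_of_consecutive a 1 (5 * b - 4)); [lia | assumption | lia | | | lia | lia | | |].
      * exists (5 * b ^ 2 - 2 * b - t). lia.
      * exists (2 * b - 1). lia.
      * replace (5 * b - 4 + 5) with (5 * b + 1) by ring.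
        replace (5 * b - 1 + 5) with (5 * b + 4) by ring. lia.
      * nia.
      * intros j R. apply gap_only_1; [lia | lia | nia].
    + apply (largest_missing_square_of_consecutive a 2 (5 * b - 4)); [lia | assumption | lia | | | lia | lia | | |].
      * exists (5 * b ^ 2 - 2 * b - 2 * t - 1). lia.
      * exists (2 * b - 1). lia.
      * replace (5 * b - 4 + 5) with (5 * b + 1) by ring.
        replace (5 * b - 1 + 5) with (5 * b + 4) by ring. lia.
      * nia.
      * intros j R. apply gap_only_2; [lia | lia |].
        assert (B : b = 0 \/ b = 1 \/ 2 <= b) by lia.
        (* For [b = 1] the interval starts exactly at [a = 13]. *)
        destruct B as [-> | [-> | B]]; [lia | lia | nia].
  - destruct H as (b & Hb & [[Hx Hr] | [Hx Hr]] & ->); rewrite Hr in Hq.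
    + apply (largest_missing_square_of_consecutive a 1 (5 * b - 1)); [lia | assumption | lia | | | lia | lia | | |].
      * exists (5 * b ^ 2 + 2 * b - t). lia.
      * exists (2 * b). lia.
      * replace (5 * b - 1 + 5) with (5 * b + 4) by ring.
        replace (5 * b + 1 + 5) with (5 * b + 6) by ring. lia.
      * nia.
      * intros j R. apply gap_only_1; [lia | lia | nia].
    + destruct (Z.eq_dec a 3) as [-> | H3].
      { assert (b = 0) as -> by nia. exact largest_missing_square_3. }
      apply (largest_missing_square_of_consecutive a 2 (5 * b - 1)); [lia | assumption | lia | | | lia | lia | | |].
      * exists (5 * b ^ 2 + 2 * b - 2 * t - 1). lia.
      * exists (2 * b). lia.
      * replace (5 * b - 1 + 5) with (5 * b + 4) by ring.
        replace (5 * b + 1 + 5) with (5 * b + 6) by ring. lia.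
      * nia.
      * intros j R. apply gap_only_2; [lia | lia |].
        assert (B : b = 0 \/ 1 <= b) by lia.
        destruct B as [-> | B]; [lia | nia].
  - destruct H as (b & Hb & [(Hx & Hr & H4) | (Hx & Hr & H2 & H27 & H32)] & ->);
      rewrite Hr in Hq.
    + apply (largest_missing_square_of_consecutive a 1 (5 * b - 2)); [lia | assumption | lia | | | lia | lia | | |].
      * exists (5 * b ^ 2 + 4 * b - t). lia.
      * exists (2 * b). lia.
      * replace (5 * b - 2 + 5) with (5 * b + 3) by ring.
        replace (5 * b + 2 + 5) with (5 * b + 7) by ring. lia.
      * assert (B : b = 0 \/ 1 <= b) by lia. destruct B as [-> | B]; [lia | nia].
      * intros j R. apply gap_only_1; [lia | lia | nia].
    + apply (largest_missing_square_of_consecutive a 2 (5 * b - 2)); [lia | assumption | lia | | | lia | lia | | |].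
      * exists (5 * b ^ 2 + 4 * b - 2 * t). lia.
      * exists (2 * b). lia.
      * replace (5 * b - 2 + 5) with (5 * b + 3) by ring.
        replace (5 * b + 2 + 5) with (5 * b + 7) by ring. lia.
      * assert (B : b = 0 \/ 1 <= b) by lia. destruct B as [-> | B]; [lia | nia].
      * intros j R. apply gap_only_2; [lia | lia |].
        assert (B : b = 0 \/ b = 1 \/ b = 2 \/ 3 <= b) by lia.
        (* [b = 1] is where 27 and 32 drop out; for [b = 2] the interval alone
           would allow [a = 80], which is not 2 modulo 5. *)
        destruct B as [-> | [-> | [-> | B]]]; [lia | lia | lia | nia].
Qed.

Theorem theorem3p3 : forall a : Z, 2 <= a -> ~ (5 | a) ->
  (exists N : Z, is_largest_missing_square (gen2 a (a + 5)) N) /\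
  (forall N : Z, is_largest_missing_square (gen2 a (a + 5)) N <->
    ((a = 2 \/ a = 4) /\ N = 1) \/
    (a = 13 /\ N = 10 ^ 2) \/
    ((a = 27 \/ a = 32) /\ N = (a - 6) ^ 2) \/
    (exists b : Z, 0 <= b /\
      (((5 * b + 2) ^ 2 <= a + 5 < (5 * b + 3) ^ 2 /\ a mod 5 = 4) \/
       ((5 * b + 2) ^ 2 <= 2 * (a + 5) < (5 * b + 3) ^ 2 /\ a mod 5 = 2)) /\
      N = (a - (5 * b - 2)) ^ 2) \/
    (exists b : Z, 0 <= b /\
      (((5 * b + 1) ^ 2 <= a + 5 < (5 * b + 4) ^ 2 /\ a mod 5 = 1) \/
       ((5 * b + 1) ^ 2 <= 2 * (a + 5) < (5 * b + 4) ^ 2 /\ a mod 5 = 3 /\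
        a <> 13)) /\
      N = (a - (5 * b - 1)) ^ 2) \/
    (exists b : Z, 0 <= b /\
      (((5 * b + 4) ^ 2 <= a + 5 < (5 * b + 6) ^ 2 /\ a mod 5 = 1) \/
       ((5 * b + 4) ^ 2 <= 2 * (a + 5) < (5 * b + 6) ^ 2 /\ a mod 5 = 3)) /\
      N = (a - (5 * b + 1)) ^ 2) \/
    (exists b : Z, 0 <= b /\
      (((5 * b + 3) ^ 2 <= a + 5 < (5 * b + 7) ^ 2 /\ a mod 5 = 4 /\ a <> 4) \/
       ((5 * b + 3) ^ 2 <= 2 * (a + 5) < (5 * b + 7) ^ 2 /\ a mod 5 = 2 /\
        a <> 2 /\ a <> 27 /\ a <> 32)) /\
      N = (a - (5 * b + 2)) ^ 2)).

Proof.
  intros a Ha Ha5.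
  destruct (case_table_has_value a Ha Ha5) as [N0 HN0].
  pose proof (case_table_sound a N0 Ha Ha5 HN0) as Hlargest.
  split; [exists N0; exact Hlargest |].
  intros N; change (is_largest_missing_square (gen2 a (a + 5)) N <-> case_table a N).
  split; [|apply case_table_sound; assumption].
  intros HN. rewrite (largest_missing_square_unique _ _ _ HN Hlargest). exact HN0.
Qed.
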